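(* Suppose that $(\mathcal A,\mathcal X)$ is a finite type cluster ensemble. Then for any $(a,x)\in\mathcal A(\mathbb R^t)\times\mathcal X(\mathbb R^t)$ there exists a seed $\mathbf i$ at which the maximum over all seeds of $$P_{\mathbf i}(a,x)=\sum_{i\in I}d_ia_ix_i$$ is attained, and such that all coordinates $x_i$ of $x$ at $\mathbf i$ are non-negative.
   Context: A seed $\mathbf i=(I,I_0,\varepsilon,d)$ consists of a finite set $I$, a subset $I_0\subset I$ of frozen elements, a $\mathbb Q$-valued function $\varepsilon=(\varepsilon_{ij})$ on $I\times I$ with $\varepsilon_{ij}\in\mathbb Z$ unless $(i,j)\in I_0\times I_0$, and positive integers $\{d_i\}_{i\in I}$ with greatest common divisor $1$ such that $\varepsilon_{ij}d_j^{-1}$ is skew-symmetric. The mutated seed $\mu_k(\mathbf i)=(I,I_0,\varepsilon',d)$, $k\in I\setminus I_0$, is given by $\varepsilon'_{ij}=-\varepsilon_{ij}$ if $k\in\{i,j\}$; $\varepsilon'_{ij}=\varepsilon_{ij}$ if $k\notin\{i,j\}$ and $\varepsilon_{ik}\varepsilon_{kj}\le 0$; $\varepsilon'_{ij}=\varepsilon_{ij}+|\varepsilon_{ik}|\varepsilon_{kj}$ if $k\notin\{i,j\}$ and $\varepsilon_{ik}\varepsilon_{kj}>0$. Mutations act on cluster coordinates by $$X'_k=X_k^{-1},\quad X'_i=X_i(1+X_k^{-\mathrm{sgn}(\varepsilon_{ik})})^{-\varepsilon_{ik}}\ (i\ne k);\qquad A_kA'_k=\prod_{\varepsilon_{kj}>0}A_j^{\varepsilon_{kj}}+\prod_{\varepsilon_{kj}<0}A_j^{-\varepsilon_{kj}},\quad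 A'_i=A_i\ (i\neq k).$$ Seed isomorphisms (relabellings preserving $I_0,\varepsilon,d$) act by relabelling coordinates. Cluster transformations are compositions of these; seeds so related are equivalent. The cluster ensemble $(\mathcal A,\mathcal X)$ is the pair of positive spaces given by the tori with coordinates $\{A_i\}$, resp. $\{X_i\}$, for all seeds equivalent to a given one, together with the cluster transformations between them. ''All seeds'' means all seeds equivalent to the given one. Seeds connected by a cluster transformation acting, up to relabelling, as the identity on all cluster coordinates are identified. Tropical points. $\mathcal X(\mathbb R^t)$ (resp. $\mathcal A(\mathbb R^t)$) is the set of points with values in the tropical semifield $\mathbb R^t$ ($\mathbb R$ with multiplication $a+b$ and addition $\max(a,b)$): a point $x$ (resp. $a$) has real coordinates $\{x_i\}$ (resp. $\{a_i\}$) for every seed, transforming under mutations by $$x'_k=-x_k,\quad x'_i=x_i-\varepsilon_{ik}\max(0,-\mathrm{sgn}(\varepsilon_{ik})x_k)\ (i\neq k),$$ $$a'_k=-a_k+\max\Bigl(\sum_{\varepsilon_{kj}>0}\varepsilon_{kj}a_j,\ \sum_{\varepsilon_{kj}<0}-\varepsilon_{kj}a_j\Bigr),\quad a'_i=a_i\ (i\neq k),$$ and is determined by its coordinates for any one seed, which may be arbitrary. The cluster ensemble is of finite type if its cluster complex has finitely many simplices, i.e. there are finitely many seeds after identifying any two seeds connected by a cluster transformation acting, up to relabelling, as the identity on all cluster coordinates.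
   Formalization: Non-negativity of the coordinates x_i at the seed is claimed only for non-frozen i; for frozen i it is false (I = I_0 = {1}, ε = 0, d = 1, x_1 = -1: the only seed has a negative coordinate). *)

(* Defs.v *)
From HB Require Import structures.
From mathcomp Require Import all_boot all_order all_algebra.
From mathcomp Require Import ring mpoly reals.

Set Implicit Arguments.
Unset Strict Implicit.
Unset Printing Implicit Defensive.

Import Order.TTheory GRing.Theory Num.Theory.
Local Open Scope ring_scope.

Record seed := Seed {
  index :> finType;
  frozen : {set index};
  eps : index -> index -> rat;
  mult : index -> nat;
  eps_int : forall i j : index,
    ~~ ((i \in frozen) && (j \in frozen)) -> eps i j \is a Num.int;
  mult_gt0 : forall i : index, (0 < mult i)%N;
  mult_gcd : \big[gcdn/0%N]_(i : index) mult i = 1%N;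
  eps_skew : forall i j : index,
    eps i j / (mult j)%:R = - (eps j i / (mult i)%:R)
}.

Definition mut_eps (s : seed) (k i j : s) : rat :=
  if (i == k) || (j == k) then - eps i j
  else if eps i k * eps k j <= 0 then eps i j
  else eps i j + `|eps i k| * eps k j.

Lemma mut_eps_int (s : seed) (k : s) : k \notin frozen s ->
  forall i j : s, ~~ ((i \in frozen s) && (j \in frozen s)) ->
  mut_eps k i j \is a Num.int.
Proof.
move=> hk i j hij; rewrite /mut_eps.
have hik : eps i k \is a Num.int by apply: eps_int; rewrite (negbTE hk) andbF.
have hkj : eps k j \is a Num.int by apply: eps_int; rewrite (negbTE hk).
have hE := eps_int hij.
case: ifP => _; first by rewrite rpredN.
case: ifP => // _; rewrite rpredD // rpredM //.
by case: ger0P => _; rewrite ?rpredN.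
Qed.

Lemma mut_eps_skew (s : seed) (k : s) (i j : s) :
  mut_eps k i j / (mult j)%:R = - (mut_eps k j i / (mult i)%:R).
Proof.
have pos (l : s) : 0 < (mult l)%:R :> rat by rewrite ltr0n mult_gt0.
have nz (l : s) : (mult l)%:R != 0 :> rat by rewrite gt_eqF.
have eT (p q : s) : eps p q = - eps q p * ((mult q)%:R / (mult p)%:R).
  by rewrite -[LHS](divfK (nz q)) eps_skew; field; rewrite !nz.
rewrite /mut_eps [(j == k) || _]orbC.
case: ifP => _; first by rewrite !mulNr eps_skew.
rewrite (eT j k) (eT k i).
set u := eps i k; set v := eps k j.
set di := (mult i)%:R; set dj := (mult j)%:R; set dk := (mult k)%:R.
have -> : - v * (dk / dj) * (- u * (di / dk)) = u * v * (di / dj).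
  by field; rewrite !nz.
rewrite (pmulr_lle0 _ (divr_gt0 (pos i) (pos j))).
case: ifP => huv; first exact: eps_skew.
have {}huv : 0 < u * v by rewrite ltNge huv.
have nuv : `|v| * u = `|u| * v.
  have [h|h|h] := ltrgt0P u; last by move: huv; rewrite h mul0r ltxx.
  - by rewrite gtr0_norm 1?mulrC // -(pmulr_rgt0 _ h).
  - by rewrite ltr0_norm ?mulrN ?mulNr 1?mulrC // -(nmulr_rgt0 _ h).
rewrite normrM normrN (gtr0_norm (divr_gt0 (pos k) (pos j))).
have -> : `|v| * (dk / dj) * (- u * (di / dk)) = - (`|u| * v) * (di / dj).
  by rewrite -nuv; field; rewrite !nz.
rewrite [eps j i]eT -/di -/dj; field; rewrite !nz //.
Qed.

Definition mutate (s : seed) (k : s) (hk : k \notin frozen s) : seed :=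
  @Seed (index s) (frozen s) (mut_eps k) (@mult s) (mut_eps_int hk)
        (@mult_gt0 s) (mult_gcd s) (mut_eps_skew k).

Record seed_iso (s t : seed) := SeedIso {
  relabel :> s -> t;
  relabel_inv : t -> s;
  relabelK : cancel relabel relabel_inv;
  relabel_invK : cancel relabel_inv relabel;
  relabel_frozen : forall i : s, (relabel i \in frozen t) = (i \in frozen s);
  relabel_eps : forall i j : s, eps (relabel i) (relabel j) = eps i j;
  relabel_mult : forall i : s, mult (relabel i) = mult i
}.

Inductive cluster_transf (s : seed) : seed -> Type :=
| ct_id : cluster_transf s s
| ct_mut (t : seed) (c : cluster_transf s t) (k : t)
    (hk : k \notin frozen t) : cluster_transf s (mutate hk)
| ct_iso (t u : seed) (c : cluster_transf s t) (f : seed_iso t u) :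
    cluster_transf s u.

(* The exponents [numq (eps i k)] below are [eps i k] itself: the direction [k]
   is not frozen, so this rational number is an integer. *)
Definition mutA (F : fieldType) (s : seed) (k : s) (A : s -> F) : s -> F :=
  fun i => if i == k then
      (\prod_(j : s | 0 < eps k j) A j ^ numq (eps k j)
       + \prod_(j : s | eps k j < 0) A j ^ (- numq (eps k j))) / A k
    else A i.

Definition mutX (F : fieldType) (s : seed) (k : s) (X : s -> F) : s -> F :=
  fun i => if i == k then (X k)^-1
    else X i * (1 + X k ^ (- sgz (eps i k))) ^ (- numq (eps i k)).

(* The common function field of the tori of [s] in the A- and X-spaces. *)
Definition ratfun (s : seed) : fieldType := {fraction {mpoly rat[#|s|]}}.

Definition coord0 (s : seed) (i : s) : ratfun s :=
  tofrac ('X_(enum_rank i) : {mpoly rat[#|s|]}).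

(* The coordinates at [t], as rational functions of those at [s]. *)
Fixpoint coordA (s t : seed) (c : cluster_transf s t) : t -> ratfun s :=
  match c in cluster_transf _ t return t -> ratfun s with
  | ct_id => @coord0 s
  | ct_mut _ c k _ => mutA k (coordA c)
  | ct_iso _ _ c f => fun i => coordA c (relabel_inv f i)
  end.

Fixpoint coordX (s t : seed) (c : cluster_transf s t) : t -> ratfun s :=
  match c in cluster_transf _ t return t -> ratfun s with
  | ct_id => @coord0 s
  | ct_mut _ c k _ => mutX k (coordX c)
  | ct_iso _ _ c f => fun i => coordX c (relabel_inv f i)
  end.

(* A seed of the ensemble generated by [s] carries the transformation leading
   to it: two seeds with isomorphic exchange data need not have the same cluster
   coordinates, and are then distinct seeds of the ensemble. *)
Record ens_seed (s : seed) := EnsSeed {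
  ens_data :> seed;
  ens_path : cluster_transf s ens_data
}.

Definition ens_mut (s : seed) (r : ens_seed s) (k : r)
    (hk : k \notin frozen r) : ens_seed s :=
  EnsSeed (ct_mut (ens_path r) hk).

Definition ens_iso (s : seed) (r : ens_seed s) (u : seed) (f : seed_iso r u) :
    ens_seed s :=
  EnsSeed (ct_iso (ens_path r) f).

(* The transition map from [r] to [r'] is the identity up to relabelling. *)
Definition identified (s : seed) (r r' : ens_seed s) : Prop :=
  exists f : seed_iso r r', forall i : r,
    coordA (ens_path r') (f i) = coordA (ens_path r) i /\
    coordX (ens_path r') (f i) = coordX (ens_path r) i.

Definition finite_type (s : seed) : Prop :=
  exists (n : nat) (e : 'I_n -> ens_seed s),
    forall r : ens_seed s, exists p : 'I_n, identified (e p) r.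

Definition trop_mutA (R : realType) (s : seed) (k : s) (a : s -> R) : s -> R :=
  fun i => if i == k then
      - a k + Num.max (\sum_(j : s | 0 < eps k j) ratr (eps k j) * a j)
                      (\sum_(j : s | eps k j < 0) - ratr (eps k j) * a j)
    else a i.

Definition trop_mutX (R : realType) (s : seed) (k : s) (x : s -> R) : s -> R :=
  fun i => if i == k then - x k
    else x i - ratr (eps i k) * Num.max 0 (- ratr (Num.sg (eps i k)) * x k).

Record tropA (R : realType) (s : seed) := TropA {
  tropA_coord :> forall r : ens_seed s, r -> R;
  tropA_mut : forall (r : ens_seed s) (k : r) (hk : k \notin frozen r) (i : r),
    @tropA_coord (ens_mut hk) i = trop_mutA k (@tropA_coord r) i;
  tropA_iso : forall (r : ens_seed s) (u : seed) (f : seed_iso r u) (i : r),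
    @tropA_coord (ens_iso f) (f i) = @tropA_coord r i
}.
Arguments tropA_coord {R s} _ r i.

Record tropX (R : realType) (s : seed) := TropX {
  tropX_coord :> forall r : ens_seed s, r -> R;
  tropX_mut : forall (r : ens_seed s) (k : r) (hk : k \notin frozen r) (i : r),
    @tropX_coord (ens_mut hk) i = trop_mutX k (@tropX_coord r) i;
  tropX_iso : forall (r : ens_seed s) (u : seed) (f : seed_iso r u) (i : r),
    @tropX_coord (ens_iso f) (f i) = @tropX_coord r i
}.
Arguments tropX_coord {R s} _ r i.

Definition pairing (R : realType) (s : seed) (a : tropA R s) (x : tropX R s)
    (r : ens_seed s) : R :=
  \sum_(i : r) (mult i)%:R * a r i * x r i.

(* Main.v *)
Require Import Defs.
From HB Require Import structures.
From mathcomp Require Import all_boot all_order all_algebra.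
From mathcomp Require Import mpoly reals ring lra.

Import Order.TTheory GRing.Theory Num.Theory.
Local Open Scope ring_scope.

(** Write [P_r (a, x)] for the pairing at the seed [r].  If [x_k <= 0], mutating
    at [k] changes it by
      [P_(mu_k r) (a, x) - P_r (a, x) = d_k |x_k| max (0, sum_j eps_kj a_j)],
    which is never negative ([pairing_mutation]).  So from a seed maximizing the
    pairing one may keep mutating at the negative coordinates of [x] without
    leaving the set of maximizers; what has to be shown is that this stops.

    The same formula shows that it does.  It holds for every tropical point [c]
    in place of [a], and the gain is strict if [x_k < 0] and
    [sum_j eps_kj c_j > 0].
    If row [k] of [eps] is not zero, such a [c] exists: the point whose
    coordinates at the given seed are [c_j = eps_kj], for which the sum is a sum
    of squares.  In finite type there are finitely many pairs (seed, direction),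
    hence finitely many such probes [c] ([finite_type_probes]), and the sum [Q]
    of the pairings of [x] with all of them never decreases under a mutation at
    a negative [x_k], and increases strictly if row [k] is not zero.  If row [k]
    is zero, then so is column [k] by skew-symmetry; the mutation changes no
    exchange coefficient and no coordinate of [x] but [x_k], whose sign it flips,
    so it does not change [Q] and increases strictly the sum [T] of the
    coordinates of [x] in such null directions.

    Therefore a seed at which [(P, Q, T)] is lexicographically maximal has no
    negative unfrozen coordinate, and it maximizes [P].  A maximal seed exists
    because [P], [Q] and [T] take finitely many values.  This last point uses
    that identified seeds have the same tropical coordinates
    ([trop_coord_identified]): identification is an equality of rational
    functions, and the tropical coordinates are the values of a degree function
    that is well defined on subtraction-free rational functions. *)

(** * Tropicalization of subtraction-free rational functions *)

Definition weight {R : realType} {n : nat} (w : 'I_n -> R) (m : 'X_{1.. n}) : R :=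
  \sum_i w i *+ m i.

Lemma weightD {R : realType} {n : nat} (w : 'I_n -> R) (m1 m2 : 'X_{1.. n}) :
  weight w (m1 + m2)%MM = weight w m1 + weight w m2.
Proof.
by rewrite /weight -big_split; apply: eq_bigr => i _; rewrite mnmDE mulrnDr.
Qed.

(** The degree of [N] for the weights [w] is [c].  Non-negativity of the
    coefficients is what makes the degree of a sum the maximum of the degrees,
    and the degree of a product the sum: no leading terms can cancel, even when
    several monomials have the same weight. *)
Definition trop_poly {R : realType} {n : nat} (w : 'I_n -> R)
    (N : {mpoly rat[n]}) (c : R) : Prop :=
  [/\ forall m, 0 <= N@_m,
      forall m, N@_m != 0 -> weight w m <= c
    & exists2 m, N@_m != 0 & weight w m = c].

Section TropPoly.
Context {R : realType} {n : nat} (w : 'I_n -> R).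
Implicit Types (N : {mpoly rat[n]}) (c : R).

Lemma trop_poly_neq0 N c : trop_poly w N c -> N != 0.
Proof. by case=> _ _ [m hm _]; apply: contraNneq hm => ->; rewrite mcoeff0. Qed.

Lemma trop_poly_unique N c c' : trop_poly w N c -> trop_poly w N c' -> c = c'.
Proof.
case=> _ le [m hm em] [_ le' [m' hm' em']].
by apply/le_anti; rewrite -{1}em le' // -{1}em' le.
Qed.

Lemma trop_polyX m : trop_poly w 'X_[m] (weight w m).
Proof.
split=> [m'|m'|]; rewrite ?mcoeffX ?ler0n //.
  by case: (m =P m') => [-> //|_]; rewrite eqxx.
by exists m; rewrite ?mcoeffX ?eqxx.
Qed.

Lemma trop_poly1 : trop_poly w 1 0.
Proof.
have := trop_polyX 0%MM; rewrite mpolyX0 /weight big1 // => i _.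
by rewrite mnm0E.
Qed.

Lemma trop_polyD N N' c c' : trop_poly w N c -> trop_poly w N' c' ->
  trop_poly w (N + N') (Num.max c c').
Proof.
case=> pos le [m hm em] [pos' le' [m' hm' em']].
have coefD_neq0 p : ((N + N')@_p != 0) = (N@_p != 0) || (N'@_p != 0).
  by rewrite mcoeffD paddr_eq0 // negb_and.
split=> [p|p|]; first by rewrite mcoeffD addr_ge0.
  rewrite coefD_neq0 le_max => /orP[/le|/le'] -> //; by rewrite orbT.
case: (leP c c') => _; [exists m'|exists m]; rewrite ?coefD_neq0 ?hm ?hm' //.
by rewrite orbT.
Qed.

Lemma trop_polyM N N' c c' : trop_poly w N c -> trop_poly w N' c' ->
  trop_poly w (N * N') (c + c').
Proof.
case=> pos le [m hm em] [pos' le' [m' hm' em']].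
split=> [p|p|].
- by rewrite mcoeffM sumr_ge0 // => k _; rewrite mulr_ge0.
- rewrite -mcoeff_msupp => /msuppM_le /allpairsP[[p1 p2] [/= h1 h2 ->]].
  by rewrite weightD lerD ?le ?le' // -mcoeff_msupp.
- exists (m + m')%MM; last by rewrite weightD em em'.
  (* [m] and [m'] may not be the only monomials with product [m + m'], but the
     other contributions to this coefficient are non-negative. *)
  rewrite gt_eqF //; apply: (@lt_le_trans _ _ (N@_m * N'@_m')).
    by rewrite mulr_gt0 // lt_neqAle eq_sym ?hm ?hm' ?pos ?pos'.
  have lt_m : (mdeg m < (mdeg (m + m')).+1)%N by rewrite ltnS mdegD leq_addr.
  have lt_m' : (mdeg m' < (mdeg (m + m')).+1)%N by rewrite ltnS mdegD leq_addl.
  rewrite mcoeffM (bigD1 (BMultinom lt_m, BMultinom lt_m')) //=.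
  by rewrite lerDl sumr_ge0 // => k _; rewrite mulr_ge0.
Qed.

End TropPoly.

(** A relation rather than a function: a fraction need not have a
    subtraction-free representation, and may have several. *)
Definition trop_frac {R : realType} {n : nat} (w : 'I_n -> R)
    (F : {fraction {mpoly rat[n]}}) (c : R) : Prop :=
  exists N D : {mpoly rat[n]}, exists cN cD : R,
  [/\ trop_poly w N cN, trop_poly w D cD, F = tofrac N / tofrac D & c = cN - cD].

Section TropFrac.
Context {R : realType} {n : nat} (w : 'I_n -> R).
Implicit Types (F : {fraction {mpoly rat[n]}}) (c : R).

Lemma tofrac_trop_neq0 {N c} : trop_poly w N c -> tofrac N != 0.
Proof. by move=> /trop_poly_neq0; rewrite tofrac_eq0. Qed.

(** Two subtraction-free representations of the same fraction give
    [N D' = N' D], and degrees of subtraction-free polynomials add up. *)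
Lemma trop_frac_unique F c c' : trop_frac w F c -> trop_frac w F c' -> c = c'.
Proof.
move=> [N [D [cN [cD [hN hD -> ->]]]]] [N' [D' [cN' [cD' [hN' hD' eF ->]]]]].
have eND : N * D' = N' * D.
  apply/eqP; rewrite -tofrac_eq (tofracM N) (tofracM N').
  have := eqr_div (tofrac N) (tofrac N') (tofrac_trop_neq0 hD) (tofrac_trop_neq0 hD').
  by move=> <-; apply/eqP.
have := trop_polyM w _ _ _ _ hN' hD; rewrite -eND => /trop_poly_unique.
by move=> /(_ _ (trop_polyM w _ _ _ _ hN hD')) => e; lra.
Qed.

Lemma trop_frac_poly N c : trop_poly w N c -> trop_frac w (tofrac N) c.
Proof.
move=> hN; exists N, 1, c, 0; split=> //; rewrite ?subr0 ?tofrac1 ?divr1 //.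
exact: trop_poly1.
Qed.

Lemma trop_frac1 : trop_frac w 1 0.
Proof.
by rewrite -tofrac1; apply: trop_frac_poly; apply: trop_poly1.
Qed.

Lemma trop_fracV F c : trop_frac w F c -> trop_frac w F^-1 (- c).
Proof.
move=> [N [D [cN [cD [hN hD -> ->]]]]]; exists D, N, cD, cN; split=> //.
  by rewrite invf_div.
by rewrite opprB.
Qed.

Lemma trop_fracM F F' c c' : trop_frac w F c -> trop_frac w F' c' ->
  trop_frac w (F * F') (c + c').
Proof.
move=> [N [D [cN [cD [hN hD -> ->]]]]] [N' [D' [cN' [cD' [hN' hD' -> ->]]]]].
exists (N * N'), (D * D'), (cN + cN'), (cD + cD').
split; [exact: trop_polyM|exact: trop_polyM| |by lra].
by rewrite (tofracM N) (tofracM D); exact: mulf_div.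
Qed.

Lemma trop_fracD F F' c c' : trop_frac w F c -> trop_frac w F' c' ->
  trop_frac w (F + F') (Num.max c c').
Proof.
move=> [N [D [cN [cD [hN hD -> ->]]]]] [N' [D' [cN' [cD' [hN' hD' -> ->]]]]].
exists (N * D' + N' * D), (D * D'), (Num.max (cN + cD') (cN' + cD)), (cD + cD').
split; [by apply: trop_polyD; apply: trop_polyM|exact: trop_polyM| |].
  rewrite (tofracD (N * D')) (tofracM N) (tofracM N') (tofracM D).
  exact: addf_div (tofrac_trop_neq0 hD) (tofrac_trop_neq0 hD').
by case: leP => ?; case: leP => ?; lra.
Qed.

Lemma trop_fracX F c (z : int) : trop_frac w F c -> trop_frac w (F ^ z) (z%:~R * c).
Proof.
move=> hF.
have nat_pow (k : nat) : trop_frac w (F ^+ k) (k%:R * c).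
  elim: k => [|k IHk]; first by rewrite mul0r expr0; exact: trop_frac1.
  by rewrite exprS -natr1 mulrDl mul1r addrC; apply: trop_fracM.
case: z => k; first exact: nat_pow.
by rewrite NegzE -exprnN mulrNz mulNr; apply: trop_fracV; apply: nat_pow.
Qed.

Lemma trop_frac_prod (I : finType) (P : pred I) (F : I -> {fraction {mpoly rat[n]}})
    (c : I -> R) : (forall i, P i -> trop_frac w (F i) (c i)) ->
  trop_frac w (\prod_(i | P i) F i) (\sum_(i | P i) c i).
Proof.
move=> h; apply: (big_ind2 (trop_frac w)) => //; first exact: trop_frac1.
by move=> ? ? ? ? ? ?; apply: trop_fracM.
Qed.

End TropFrac.

(** * Tropical coordinates of identified seeds *)

Lemma ratr_numq {R : realType} (q : rat) : q \is a Num.int ->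
  ratr q = (numq q)%:~R :> R.
Proof. by move=> hq; rewrite -{1}(numqK hq) ratr_int. Qed.

Lemma eps_diag (s : seed) (k : s) : eps k k = 0.
Proof.
have := eps_skew k k; move/eqP; rewrite -subr_eq0 opprK -mulr2n mulrn_eq0 /=.
by rewrite mulf_eq0 invr_eq0 pnatr_eq0 -[_ == 0%N]negbK -lt0n mult_gt0 orbF => /eqP.
Qed.

Lemma eps_int_row (s : seed) (k : s) (hk : k \notin frozen s) (j : s) :
  eps k j \is a Num.int.
Proof. by apply: eps_int; rewrite (negbTE hk). Qed.

Lemma eps_int_col (s : seed) (k : s) (hk : k \notin frozen s) (j : s) :
  eps j k \is a Num.int.
Proof. by apply: eps_int; rewrite (negbTE hk) andbF. Qed.

Section TropCoord.
Context {R : realType} {s : seed}.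

Lemma trop_frac_coord0 (b : s -> R) (i : s) :
  trop_frac (b \o enum_val) (@Defs.coord0 s i) (b i).
Proof.
apply: trop_frac_poly.
suff <- : weight (b \o enum_val) (mnm1 (enum_rank i)) = b i by exact: trop_polyX.
rewrite /weight (bigD1 (enum_rank i)) //= mnm1E eqxx enum_rankK big1 ?addr0 //.
by move=> j hj; rewrite mnm1E eq_sym (negbTE hj).
Qed.

Lemma trop_frac_mutA {n} (w : 'I_n -> R) {t : seed} (k : t) (hk : k \notin frozen t)
    (A : t -> {fraction {mpoly rat[n]}}) (b : t -> R) :
  (forall i, trop_frac w (A i) (b i)) ->
  forall i, trop_frac w (mutA k A i) (trop_mutA k b i).
Proof.
move=> h i; rewrite /mutA /trop_mutA; case: eqP => // _; rewrite [- b k + _]addrC.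
apply: trop_fracM; last exact: trop_fracV.
apply: trop_fracD; apply: trop_frac_prod => j _.
  by rewrite ratr_numq ?eps_int_row //; apply: trop_fracX.
by rewrite ratr_numq ?eps_int_row // -mulrNz; apply: trop_fracX.
Qed.

Lemma trop_frac_mutX {n} (w : 'I_n -> R) {t : seed} (k : t) (hk : k \notin frozen t)
    (X : t -> {fraction {mpoly rat[n]}}) (y : t -> R) :
  (forall i, trop_frac w (X i) (y i)) ->
  forall i, trop_frac w (mutX k X i) (trop_mutX k y i).
Proof.
move=> h i; rewrite /mutX /trop_mutX; case: eqP => _; first exact: trop_fracV.
apply: trop_fracM => //.
rewrite (ratr_numq (eps i k)) ?eps_int_col // -mulNr -mulrNz; apply: trop_fracX.
apply: trop_fracD; first exact: trop_frac1.
by rewrite sgrEz ratr_int -mulrNz; apply: trop_fracX.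
Qed.

Definition base : ens_seed s := EnsSeed (ct_id s).

(** The coordinates of a tropical point are the degrees of the cluster
    coordinates, for the weights given by its coordinates at the base seed:
    the tropical mutation is the rational one with product, sum and quotient
    replaced by sum, maximum and difference. *)
Lemma trop_frac_coordA (a : tropA R s) (r : ens_seed s) (i : r) :
  trop_frac (a base \o enum_val) (coordA (ens_path r) i) (a r i).
Proof.
case: r i => t c; elim: c => {t} [|t c IHc k hk|t u c IHc f] i.
- exact: trop_frac_coord0.
- rewrite [a _ _](@tropA_mut _ _ a (EnsSeed c) k hk i); exact: trop_frac_mutA.
- rewrite /= -{2}(relabel_invK f i) [a _ _](@tropA_iso _ _ a (EnsSeed c) u f); exact: IHc.
Qed.

Lemma trop_frac_coordX (x : tropX R s) (r : ens_seed s) (i : r) :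
  trop_frac (x base \o enum_val) (coordX (ens_path r) i) (x r i).
Proof.
case: r i => t c; elim: c => {t} [|t c IHc k hk|t u c IHc f] i.
- exact: trop_frac_coord0.
- rewrite [x _ _](@tropX_mut _ _ x (EnsSeed c) k hk i); exact: trop_frac_mutX.
- rewrite /= -{2}(relabel_invK f i) [x _ _](@tropX_iso _ _ x (EnsSeed c) u f); exact: IHc.
Qed.

(** Identified seeds have the same cluster coordinates as rational functions,
    and the degree of a rational function is unique. *)
Lemma trop_coord_identified (r r' : ens_seed s) : identified r r' ->
  exists f : seed_iso r r',
    (forall (a : tropA R s) i, a r' (f i) = a r i) /\
    (forall (x : tropX R s) i, x r' (f i) = x r i).
Proof.
move=> [f hf]; exists f; split=> [a|x] i; have [hA hX] := hf i.
  apply: (trop_frac_unique _ _ _ _ _ (trop_frac_coordA a r i)).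
  by rewrite -hA; apply: trop_frac_coordA.
apply: (trop_frac_unique _ _ _ _ _ (trop_frac_coordX x r i)).
by rewrite -hX; apply: trop_frac_coordX.
Qed.

End TropCoord.

(** * Variation of the pairing under a mutation *)

Lemma mult_eps (R : realType) (t : seed) (i k : t) :
  (mult i)%:R * ratr (eps i k) = - ((mult k)%:R * ratr (eps k i)) :> R.
Proof.
have nz (l : t) : (mult l)%:R != 0 :> rat by rewrite pnatr_eq0 -lt0n mult_gt0.
suff e : (mult i)%:R * eps i k = - ((mult k)%:R * eps k i).
  by rewrite -!(ratr_nat R) -!rmorphM e rmorphN.
have e := eps_skew i k.
rewrite -[eps i k](divfK (nz k)) e.
by field; rewrite nz.
Qed.

Lemma eps_opp_sign (t : seed) (i k : t) : (0 < eps i k) = (eps k i < 0).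
Proof.
have pos (l : t) : 0 < (mult l)%:R^-1 :> rat by rewrite invr_gt0 ltr0n mult_gt0.
by rewrite -(pmulr_lgt0 _ (pos k)) eps_skew oppr_gt0 pmulr_llt0.
Qed.

(** Put [Sp] and [Sn] for the two sums whose maximum enters [a'_k].  Since
    [y_k <= 0], the coordinate [y_i] changes by [eps_ik y_k] if [eps_ik > 0], and
    not at all otherwise; as [d_i eps_ik = - d_k eps_ki], these changes contribute
    [d_k y_k Sn].  Direction [k] itself contributes [- d_k y_k max (Sp, Sn)], and
    [max (Sp, Sn) - Sn = max (0, Sp - Sn)], where [Sp - Sn] is the sum in the
    statement. *)
Lemma pairing_mutation {R : realType} {t : seed} (k : t) (b y : t -> R) :
  y k <= 0 ->
  \sum_i (mult i)%:R * trop_mutA k b i * trop_mutX k y i =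
  \sum_i (mult i)%:R * b i * y i
    + (mult k)%:R * (- y k) * Num.max 0 (\sum_j ratr (eps k j) * b j).
Proof.
move=> yk0.
pose Sp := \sum_(j : t | 0 < eps k j) ratr (eps k j) * b j.
pose Sn := \sum_(j : t | eps k j < 0) - ratr (eps k j) * b j.
have -> : \sum_j ratr (eps k j) * b j = Sp - Sn.
  rewrite /Sp /Sn [X in _ = X - _]big_mkcond [X in _ - X]big_mkcond -sumrB; apply: eq_bigr => j _.
  by case: ltrgt0P => [||->]; rewrite ?rmorph0; lra.
have -> : Num.max 0 (Sp - Sn) = Num.max Sp Sn - Sn.
  by case: leP => ?; case: leP => ?; lra.
pose u := (mult k)%:R * - y k.
transitivity (\sum_i ((mult i)%:R * b i * y i
    + ((if i == k then u * Num.max Sp Sn else 0)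
       - u * (if eps k i < 0 then - ratr (eps k i) * b i else 0))));
  last first.
  rewrite big_split /= sumrB -big_mkcond big_pred1_eq -big_distrr /=.
  by rewrite -[\sum_(i : t) (if _ then _ else _)]big_mkcond -/Sn -/u mulrBr.
apply: eq_bigr => i _; rewrite /trop_mutA /trop_mutX -/Sp -/Sn /u.
case: eqP => [->|/eqP nik]; first by rewrite eps_diag ltxx; ring.
rewrite -eps_opp_sign sub0r.
have := @mult_eps R t i k; set di := (mult i)%:R; set dk := (mult k)%:R.
case: ltrgt0P => [he|he|->] eik.
- rewrite gtr0_sg // rmorph1 max_r; last by lra.
  transitivity (di * b i * y i + di * ratr (eps i k) * (b i * y k)); first by ring.
  by rewrite eik; ring.
- by rewrite ltr0_sg // rmorphN rmorph1 max_l; [ring|lra].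
- by rewrite rmorph0; ring.
Qed.

(** * Tropical points with prescribed coordinates *)

Lemma trop_mutA_ext {R : realType} {t : seed} (k : t) (b b' : t -> R) :
  b =1 b' -> trop_mutA k b =1 trop_mutA k b'.
Proof.
move=> e i; rewrite /trop_mutA !e; case: eqP => // _.
by congr (_ + Num.max _ _); apply: eq_bigr => j _; rewrite e.
Qed.

(** The exchange relation involves row [k] of [eps] only up to a global sign,
    and no [b k], so the same matrix undoes the mutation.  Using it in place of
    the mutated matrix avoids comparing a seed with its double mutation. *)
Lemma trop_mutAK {R : realType} {t : seed} (k : t) (b : t -> R) :
  trop_mutA k (trop_mutA k b) =1 b.
Proof.
have off (P : pred rat) (j : t) : P (eps k j) -> ~~ P 0 -> (j == k) = false.
  by move=> Pj nP0; apply/eqP => ejk; move: Pj; rewrite ejk eps_diag (negbTE nP0).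
move=> i; rewrite {1}/trop_mutA; case: eqP => [->|/eqP ne]; last first.
  by rewrite /trop_mutA (negbTE ne).
set M := Num.max _ _; rewrite /trop_mutA eqxx opprD opprK -/M -addrA.
suff -> : Num.max (\sum_(j : t | 0 < eps k j) ratr (eps k j) * b j)
     (\sum_(j : t | eps k j < 0) - ratr (eps k j) * b j) = M by rewrite addNr addr0.
rewrite /M /trop_mutA; congr Num.max; apply: eq_bigr => j hj.
  by rewrite (off (fun q => 0 < q)) ?ltxx.
by rewrite (off (fun q => q < 0)) ?ltxx.
Qed.

Section Transport.
Context {R : realType} {s : seed}.

Fixpoint transportA (t : seed) (c : cluster_transf s t) (b : s -> R) : t -> R :=
  match c in cluster_transf _ t return t -> R with
  | ct_id => b
  | ct_mut _ c k _ => trop_mutA k (transportA _ c b)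
  | ct_iso _ _ c f => fun i => transportA _ c b (relabel_inv f i)
  end.

(** Every step of a path is invertible on tropical coordinates, which is why
    they can be prescribed at any seed and not only at the base one. *)
Lemma transportA_surj (t : seed) (c : cluster_transf s t) (b' : t -> R) :
  exists b, transportA t c b =1 b'.
Proof.
elim: c b' => {t} [|t c IHc k hk|t u c IHc f] b'; first by exists b'.
- have [b hb] := IHc (trop_mutA k (b' : t -> R)); exists b => i /=.
  by rewrite (trop_mutA_ext _ _ _ hb) trop_mutAK.
- have [b hb] := IHc (b' \o f); exists b => i /=.
  by rewrite hb /= relabel_invK.
Qed.

Lemma tropA_with_coord (r : ens_seed s) (b' : r -> R) :
  exists a : tropA R s, forall i, a r i = b' i.
Proof.
have [b hb] := transportA_surj _ (ens_path r) b'.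
have hmut (q : ens_seed s) (k : q) (hk : k \notin frozen q) (i : q) :
  transportA _ (ens_path (ens_mut hk)) b i = trop_mutA k (transportA _ (ens_path q) b) i.
  by [].
have hiso (q : ens_seed s) (u : seed) (f : seed_iso q u) (i : q) :
  transportA _ (ens_path (ens_iso f)) b (f i) = transportA _ (ens_path q) b i.
  by rewrite /= relabelK.
by exists (@TropA R s (fun q => transportA _ (ens_path q) b) hmut hiso).
Qed.

End Transport.

(** * The maximizing seed *)

Section Maximum.
Context {R : realType} {s : seed}.

Lemma pairing_identified (a : tropA R s) (x : tropX R s) (r r' : ens_seed s) :
  identified r r' -> pairing a x r' = pairing a x r.
Proof.
move=> /(@trop_coord_identified R)[f [hA hX]]; rewrite /pairing.
rewrite (reindex f) /=; last first.
  by apply: onW_bij; exists (relabel_inv f); [exact: relabelK|exact: relabel_invK].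
by apply: eq_bigr => i _; rewrite hA hX relabel_mult.
Qed.

Lemma pairing_ens_mut (a : tropA R s) (x : tropX R s) (r : ens_seed s) (k : r)
    (hk : k \notin frozen r) : x r k <= 0 ->
  pairing a x (ens_mut hk) = pairing a x r
    + (mult k)%:R * (- x r k) * Num.max 0 (\sum_j ratr (eps k j) * a r j).
Proof.
move=> xk0; rewrite -(pairing_mutation _ (a r)) //; apply: eq_bigr => i _.
by rewrite tropA_mut tropX_mut.
Qed.

Lemma finite_type_argmax {d : Order.disp_t} {T : orderType d} (f : ens_seed s -> T) :
  finite_type s -> (forall r r', identified r r' -> f r' = f r) ->
  exists r, forall r', (f r' <= f r)%O.
Proof.
move=> [n [e he]] hf; have [p0 _] := he base.
case: (@arg_maxP _ _ _ p0 predT (f \o e)) => // p _ hp; exists (e p) => r'.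
by have [q /hf ->] := he r'; exact: hp.
Qed.

(** For each of the finitely many representatives of seeds and each direction
    [k] of it, take the point with coordinates [eps k j] there; the sum is then
    the sum of the squares of row [k]. *)
Lemma finite_type_probes : finite_type s ->
  exists (I : finType) (c : I -> tropA R s), forall (r : ens_seed s) (k : r),
    ~~ [forall j, eps k j == 0] ->
    exists i, 0 < \sum_j ratr (eps k j) * c i r j.
Proof.
move=> [n [e he]]; pose I : finType := {p : 'I_n & e p}.
have probe (i : I) : exists c : tropA R s,
    forall j, c (e (tag i)) j = ratr (eps (tagged i) j).
  exact: tropA_with_coord.
have [c hc] := fin_all_exists probe.
exists I, c => r k /forallPn[j hj]; have [p hp] := he r.
have [f [hf _]] := trop_coord_identified (R := R) _ _ hp.
pose i : I := existT _ p (relabel_inv f k); exists i.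
have -> : \sum_j ratr (eps k j) * c i r j = \sum_j (ratr (eps k j) : R) ^+ 2.
  apply: eq_bigr => l _; rewrite expr2; congr (_ * _).
  by rewrite -(relabel_invK f l) hf (hc i) -(relabel_eps f) !relabel_invK.
rewrite (bigD1 j) //= ltr_wpDr ?sumr_ge0 // => [l _|]; first exact: sqr_ge0.
by rewrite exprn_even_gt0 //= fmorph_eq0.
Qed.

(** Null directions have to be treated apart: there the pairing of [x] with
    any point is unchanged by the mutation. *)
Definition null_sum (x : tropX R s) (r : ens_seed s) : R :=
  \sum_(k : r | (k \notin frozen r) && [forall j, eps k j == 0]) x r k.

Lemma null_sum_identified (x : tropX R s) (r r' : ens_seed s) :
  identified r r' -> null_sum x r' = null_sum x r.
Proof.
move=> /(@trop_coord_identified R)[f [_ hX]]; rewrite /null_sum.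
rewrite (reindex f) /=; last first.
  by apply: onW_bij; exists (relabel_inv f); [exact: relabelK|exact: relabel_invK].
apply: eq_big => [k|k _]; last exact: hX.
rewrite relabel_frozen; congr (_ && _); apply/forallP/forallP => h j.
  by rewrite -(relabel_eps f).
by rewrite -(relabel_invK f j) relabel_eps.
Qed.

(** Mutation in a null direction fixes [eps], hence the set of null
    directions, and all coordinates of [x] but [x_k], whose sign it flips. *)
Lemma null_sum_ens_mut (x : tropX R s) (r : ens_seed s) (k : r)
    (hk : k \notin frozen r) : [forall j, eps k j == 0] ->
  null_sum x (ens_mut hk) = null_sum x r - x r k *+ 2.
Proof.
move=> /forallP row0; have {}row0 j : eps k j = 0 by apply/eqP.
have col0 j : eps j k = 0.
  by apply/eqP; rewrite eq_le !leNgt eps_opp_sign -[eps j k < 0]eps_opp_sign row0 ltxx.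
have eps_mut (i j : r) : mut_eps k i j = eps i j.
  rewrite /mut_eps col0 mul0r lexx; case: ifP => // /orP[]/eqP->.
    by rewrite row0 oppr0.
  by rewrite col0 oppr0.
rewrite /null_sum.
have Pk : (k \notin frozen r) && [forall j, eps k j == 0].
  by rewrite hk; apply/forallP => j; rewrite row0.
rewrite [in RHS](bigD1 k) //=.
rewrite (eq_bigl (fun i : r => (i \notin frozen r) && [forall j, eps i j == 0])); last first.
  by move=> i /=; congr (_ && _); apply: eq_forallb => j; rewrite eps_mut.
rewrite (bigD1 (k : r)) //= tropX_mut /trop_mutX eqxx.
rewrite (eq_bigr (fun i => x r i)) => [|i /andP[_ nik]]; first by ring.
by rewrite tropX_mut /trop_mutX (negbTE nik) col0 rmorph0 mul0r subr0.
Qed.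

End Maximum.

Theorem theorem5p2 (R : realType) (s : seed) (fin : finite_type s)
    (a : tropA R s) (x : tropX R s) :
  exists r : ens_seed s,
    (forall r' : ens_seed s, pairing a x r' <= pairing a x r) /\
    (forall i : r, i \notin frozen r -> 0 <= x r i).
Proof.
have [I [c hc]] := finite_type_probes (R := R) fin.
pose probe_sum r := \sum_(i : I) pairing (c i) x r.
pose rank (r : ens_seed s) : R *l (R *l R) :=
  (pairing a x r, (probe_sum r, null_sum x r)).
have [|r rank_max] := finite_type_argmax rank fin.
  move=> r r' idr; rewrite /rank (pairing_identified _ _ _ _ idr).
  rewrite (null_sum_identified _ _ _ idr) /probe_sum.
  by under eq_bigr do rewrite (pairing_identified _ _ _ _ idr).
exists r; split=> [r'|k hk].
  by have := rank_max r'; rewrite lexi_pair => /andP[].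
rewrite leNgt; apply/negP => xk_lt0.
have gain b := pairing_ens_mut b x r k hk (ltW xk_lt0).
have dx_gt0 : 0 < (mult k)%:R * - x r k :> R.
  by rewrite mulr_gt0 ?ltr0n ?mult_gt0 // oppr_gt0.
have pairing_le b : pairing b x r <= pairing b x (ens_mut hk).
  by rewrite gain lerDl mulr_ge0 ?(ltW dx_gt0) // le_max lexx.
have := rank_max (ens_mut hk); rewrite /rank !lexi_pair pairing_le /=.
have probe_le : probe_sum r <= probe_sum (ens_mut hk) by apply: ler_sum.
rewrite probe_le /= => /and3P[_ probe_ge null_ge].
have [row0|/hc[i hi]] := boolP [forall j, eps k j == 0].
  by move: null_ge; rewrite null_sum_ens_mut //; lra.
move: probe_ge; apply/negP; rewrite -ltNge /probe_sum.
rewrite (bigD1 i) //= [ltRHS](bigD1 i) //= ltr_leD //; last exact: ler_sum.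
by rewrite gain ltrDl mulr_gt0 // lt_max hi orbT.
Qed.
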